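(* Let $A\in\mathbb{R}^{n\times n}$ be symmetric positive definite, $n=N_f+N_c$, with leading $N_f\times N_f$ block $A_{ff}$ and upper-right $N_f\times N_c$ block $A_{fc}$. Let $X\in\mathbb{R}^{n\times n}$ be spectrally equivalent to the symmetrized relaxation operator $\widetilde{M}$, with constants $0<c_1\le c_2$, and with leading $N_f\times N_f$ block $X_{ff}$; suppose $A_{ff}$ and $X_{ff}$ are symmetric and positive definite. Let $B=\begin{bmatrix} B_f \\ B_c \end{bmatrix}\in\mathbb{R}^{n\times n_B}$ have $A$-orthonormal columns, where $B_f\in\mathbb{R}^{N_f\times n_B}$ and $B_c\in\mathbb{R}^{N_c\times n_B}$. Let $\tau\in[0,1)$, and let $\mathcal{N}\subseteq\{1,\dots,N_f\}\times\{1,\dots,N_c\}$ be a fixed sparsity pattern. Let $\mathcal{H}=\{W\in\mathbb{R}^{N_f\times N_c} : W_{ij}=0 \text{ if }(i,j)\notin\mathcal{N}\}$, a Hilbert space with the Frobenius inner product, and define $$\mathcal{F}(W)=\frac{\tau}{2}\langle A_{ff}W,W\rangle_F+\frac{c_2(1-\tau)}{2}\langle X_{ff}WB_cB_c^T,W\rangle_F-\langle W,\;c_2(1-\tau)X_{ff}B_fB_c^T-\tau A_{fc}\rangle_F .$$ Let $\hat{\mathcal{L}}:\mathcal{H}\to\mathcal{H}$ and $\hat{\mathcal{B}}\in\mathcal{H}$ be the restrictions to the sparsity pattern $\mathcal{N}$ of $\mathcal{L}W=\tau A_{ff}W+c_2(1-\tau)X_{ff}WB_cB_c^T$ and $\mathcal{B}=c_2(1-\tau)X_{ff}B_fB_c^T-\tau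 A_{fc}$, respectively, so that on $\mathcal{H}$ one has $\mathcal{F}(W)=\frac12\langle\hat{\mathcal{L}}W,W\rangle_F-\langle W,\hat{\mathcal{B}}\rangle_F$. Then $\hat{\mathcal{L}}$ is self-adjoint and positive definite on $\mathcal{H}$ with respect to $\langle\cdot,\cdot\rangle_F$, and $\mathcal{F}$ has a unique minimizer over $\mathcal{H}$, which is the unique solution $W\in\mathcal{H}$ of $$\hat{\mathcal{L}}W=\hat{\mathcal{B}}.$$
   Context: $\langle Y,Z\rangle_F=\sum_{ij}Y_{ij}Z_{ij}$ is the Frobenius inner product. ''$A$-orthonormal columns'' means $B^TAB=I$. The restriction of a matrix $Z\in\mathbb{R}^{N_f\times N_c}$ to $\mathcal{N}$ is the matrix in $\mathcal{H}$ whose $(i,j)$ entry is $Z_{ij}$ if $(i,j)\in\mathcal{N}$ and $0$ otherwise; thus $(\hat{\mathcal{L}}W)_{ij}=(\mathcal{L}W)_{ij}$ for $(i,j)\in\mathcal{N}$ and $(\hat{\mathcal{L}}W)_{ij}=0$ for $(i,j)\notin\mathcal{N}$, and similarly for $\hat{\mathcal{B}}$. The symmetrized relaxation operator is $\widetilde{M}=M^T(M+M^T-A)^{-1}M$, where $M$ is a relaxation operator with $\|I-M^{-1}A\|_A<1$ (equivalently, $M+M^T-A$ is symmetric positive definite), and $\|\cdot\|_A$ is the norm induced by $\|\mathbf{v}\|_A^2=\langle A\mathbf{v},\mathbf{v}\rangle$. Spectral equivalence of $X$ to $\widetilde{M}$ with constants $0<c_1\le c_2$ means $c_1\mathbf{v}^TX\mathbf{v}\le\mathbf{v}^T\widetilde{M}\mathbf{v}\le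 c_2\mathbf{v}^TX\mathbf{v}$ for all $\mathbf{v}$. The matrix $W$ is the fine-point block of an interpolation operator $P=\begin{bmatrix} W \\ I \end{bmatrix}$, and the columns of $B$ are candidate vectors to be interpolated accurately.
   Formalization: For τ = 0 only, it is additionally assumed that for each row i the rows of B_c indexed by {j : (i,j) ∈ N} are linearly independent; without this the claim fails at τ = 0 (e.g. B_c = 0 gives L̂ = 0). *)

(* Defs.v *)
From HB Require Import structures.
From mathcomp Require Import all_boot all_order all_algebra.
From mathcomp Require Import boolp classical_sets reals.

Set Implicit Arguments.
Unset Strict Implicit.
Unset Printing Implicit Defensive.

Import Order.TTheory GRing.Theory Num.Theory.
Local Open Scope classical_set_scope.
Local Open Scope ring_scope.

Definition frob (R : realType) (m n : nat) (Y Z : 'M[R]_(m, n)) : R :=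
  \sum_(i < m) \sum_(j < n) Y i j * Z i j.

Definition qform (R : realType) (n : nat) (A : 'M[R]_n) (v : 'cV[R]_n) : R :=
  (v^T *m A *m v) 0 0.

Definition sym_posdef (R : realType) (n : nat) (A : 'M[R]_n) : Prop :=
  A^T = A /\ forall v : 'cV[R]_n, v != 0 -> 0 < qform A v.

Definition energy_norm (R : realType) (n : nat) (A : 'M[R]_n) (v : 'cV[R]_n) : R :=
  Num.sqrt (qform A v).

(* For A symmetric positive definite the set below is bounded, so that [sup]
   (which is 0 on unbounded sets) is its actual least upper bound. *)
Definition energy_opnorm (R : realType) (n : nat) (A E : 'M[R]_n) : R :=
  sup [set energy_norm A (E *m v) | v in [set v : 'cV[R]_n | energy_norm A v <= 1]].

Definition relaxation_operator (R : realType) (n : nat) (A M : 'M[R]_n) : Prop :=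
  M \in unitmx /\ energy_opnorm A (1%:M - invmx M *m A) < 1.

Definition symmetrized_relaxation (R : realType) (n : nat) (A M : 'M[R]_n) : 'M[R]_n :=
  M^T *m invmx (M + M^T - A) *m M.

Definition spectrally_equivalent (R : realType) (n : nat) (c1 c2 : R)
    (X Mt : 'M[R]_n) : Prop :=
  [/\ 0 < c1, c1 <= c2 &
      forall v : 'cV[R]_n,
        c1 * qform X v <= qform Mt v /\ qform Mt v <= c2 * qform X v].

Definition orthonormal_cols (R : realType) (n k : nat) (A : 'M[R]_n)
    (B : 'M[R]_(n, k)) : Prop :=
  B^T *m A *m B = 1%:M.

Definition pattern_space (R : realType) (Nf Nc : nat) (N : {set 'I_Nf * 'I_Nc}) :
    set 'M[R]_(Nf, Nc) :=
  [set W | forall i j, (i, j) \notin N -> W i j = 0].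

Definition restrict (R : realType) (Nf Nc : nat) (N : {set 'I_Nf * 'I_Nc})
    (Z : 'M[R]_(Nf, Nc)) : 'M[R]_(Nf, Nc) :=
  \matrix_(i, j) if (i, j) \in N then Z i j else 0.

Section Functional.
Context (R : realType) (Nf Nc nB : nat).
Variables (tau c2 : R) (A X : 'M[R]_(Nf + Nc)) (B : 'M[R]_(Nf + Nc, nB)).
Implicit Type W : 'M[R]_(Nf, Nc).

Let Aff := ulsubmx A.
Let Afc := ursubmx A.
Let Xff := ulsubmx X.
Let Bf := usubmx B.
Let Bc := dsubmx B.

Definition Lop W : 'M[R]_(Nf, Nc) :=
  tau *: (Aff *m W) + (c2 * (1 - tau)) *: (Xff *m W *m Bc *m Bc^T).

Definition Brhs : 'M[R]_(Nf, Nc) :=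
  (c2 * (1 - tau)) *: (Xff *m Bf *m Bc^T) - tau *: Afc.

Definition Ffun W : R :=
  tau / 2 * frob (Aff *m W) W
  + c2 * (1 - tau) / 2 * frob (Xff *m W *m Bc *m Bc^T) W
  - frob W ((c2 * (1 - tau)) *: (Xff *m Bf *m Bc^T) - tau *: Afc).

Definition Lhat (N : {set 'I_Nf * 'I_Nc}) W : 'M[R]_(Nf, Nc) := restrict N (Lop W).

Definition Bhat (N : {set 'I_Nf * 'I_Nc}) : 'M[R]_(Nf, Nc) := restrict N Brhs.

End Functional.

(* For each row i of W, the rows of Bc with indices in {j | (i, j) \in N} are
   linearly independent.  When tau = 0 this is exactly what makes [Lhat]
   nonsingular on [pattern_space N] (take Bc = 0 for a failure). *)
Definition pattern_rows_independent (R : realType) (Nf Nc nB : nat)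
    (N : {set 'I_Nf * 'I_Nc}) (Bc : 'M[R]_(Nc, nB)) : Prop :=
  forall (i : 'I_Nf) (v : 'rV[R]_Nc),
    (forall j, (i, j) \notin N -> v 0 j = 0) -> v *m Bc = 0 -> v = 0.

Definition selfadjoint_on (R : realType) (m n : nat) (H : set 'M[R]_(m, n))
    (T : 'M[R]_(m, n) -> 'M[R]_(m, n)) : Prop :=
  [/\ forall U, H U -> H (T U),
      forall (a : R) U V, H U -> H V -> T (a *: U + V) = a *: T U + T V &
      forall U V, H U -> H V -> frob (T U) V = frob U (T V)].

Definition posdef_on (R : realType) (m n : nat) (H : set 'M[R]_(m, n))
    (T : 'M[R]_(m, n) -> 'M[R]_(m, n)) : Prop :=
  forall U, H U -> U != 0 -> 0 < frob (T U) U.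

Definition minimizer_on (R : realType) (m n : nat) (H : set 'M[R]_(m, n))
    (f : 'M[R]_(m, n) -> R) (W : 'M[R]_(m, n)) : Prop :=
  H W /\ forall V, H V -> f W <= f V.

(* Main.v *)
Require Import Defs.
From mathcomp Require Import all_boot all_order all_algebra.
From mathcomp Require Import boolp classical_sets reals.
From mathcomp Require Import ring.
From HB Require Import structures.
Import Order.TTheory GRing.Theory Num.Theory.
Local Open Scope ring_scope.

(** The operator W |-> tau A_ff W + c2 (1 - tau) X_ff W B_c B_c^T is Frobenius
    self-adjoint, and its quadratic form is
    tau <A_ff W, W> + c2 (1 - tau) <X_ff (W B_c), W B_c>. The first term is
    positive on W != 0 when tau > 0; when tau = 0 the second one is, since W B_c
    vanishes on the pattern space only for W = 0. Restriction to the pattern is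
    the orthogonal projection onto the pattern space, so these properties pass
    to the restricted operator. Being injective on a finite-dimensional space,
    it is onto, and the solution is the unique minimizer by completing the
    square. *)

Section Frobenius.
Context {R : realType} {m n : nat}.
Implicit Types (U V Y Z : 'M[R]_(m, n)).

Lemma frobE Y Z : frob Y Z = \tr (Y^T *m Z).
Proof.
rewrite /frob /mxtrace exchange_big; apply: eq_bigr => j _.
by rewrite mxE; apply: eq_bigr => i _; rewrite mxE.
Qed.

Lemma frobC Y Z : frob Y Z = frob Z Y.
Proof. by rewrite !frobE -mxtrace_tr trmx_mul trmxK. Qed.

Lemma frobDl U V Z : frob (U + V) Z = frob U Z + frob V Z.
Proof. by rewrite !frobE linearD mulmxDl linearD. Qed.

Lemma frobNl U Z : frob (- U) Z = - frob U Z.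
Proof. by rewrite !frobE linearN mulNmx linearN. Qed.

Lemma frobZl a U Z : frob (a *: U) Z = a * frob U Z.
Proof. by rewrite !frobE linearZ /= -scalemxAl linearZ. Qed.

Lemma frobDr Z U V : frob Z (U + V) = frob Z U + frob Z V.
Proof. by rewrite frobC frobDl !(frobC Z). Qed.

Lemma frobNr Z U : frob Z (- U) = - frob Z U.
Proof. by rewrite frobC frobNl (frobC Z). Qed.

Lemma frob0l Z : frob 0 Z = 0.
Proof. by rewrite -(scale0r 0) frobZl mul0r. Qed.

Lemma frob_mull (S : 'M[R]_m) Y Z : frob (S *m Y) Z = frob Y (S^T *m Z).
Proof. by rewrite !frobE trmx_mul mulmxA. Qed.

Lemma frob_mull_sym (S : 'M[R]_m) Y Z :
  S^T = S -> frob (S *m Y) Z = frob (S *m Z) Y.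
Proof. by move=> symS; rewrite frob_mull symS frobC. Qed.

(** Left multiplication acts on each column separately; this carries positivity of [S] on vectors
    over to matrices. *)
Lemma frob_mull_qform (S : 'M[R]_m) Y :
  frob (S *m Y) Y = \sum_(j < n) qform S (col j Y).
Proof.
rewrite frobC frobE mulmxA /mxtrace; apply: eq_bigr => j _.
rewrite /qform tr_col -row_mul [LHS]mxE [RHS]mxE.
by apply: eq_bigr => i _; rewrite !mxE.
Qed.

End Frobenius.

Lemma frob_mulr {R : realType} {m n p : nat} (Y : 'M[R]_(m, n))
    (C : 'M[R]_(n, p)) (Z : 'M[R]_(m, p)) : frob (Y *m C) Z = frob Y (Z *m C^T).
Proof. by rewrite !frobE trmx_mul -mulmxA mxtrace_mulC mulmxA. Qed.

Lemma qform_ge0 {R : realType} {n : nat} (S : 'M[R]_n) (v : 'cV[R]_n) :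
  sym_posdef S -> 0 <= qform S v.
Proof.
move=> [_ Sgt0]; have [->|/Sgt0/ltW//] := eqVneq v 0.
by rewrite /qform mulmx0 mxE.
Qed.

Lemma frob_posdef_ge0 {R : realType} {m n : nat} (S : 'M[R]_m) (Y : 'M[R]_(m, n)) :
  sym_posdef S -> 0 <= frob (S *m Y) Y.
Proof.
by move=> Spos; rewrite frob_mull_qform sumr_ge0 // => j _; apply: qform_ge0.
Qed.

(** A vanishing sum of nonnegative column forms has only zero terms, and definiteness then kills
    every column of [Y]. *)
Lemma frob_posdef_gt0 {R : realType} {m n : nat} (S : 'M[R]_m) (Y : 'M[R]_(m, n)) :
  sym_posdef S -> Y != 0 -> 0 < frob (S *m Y) Y.
Proof.
move=> Spos; have [_ Sgt0] := Spos.
rewrite lt_def frob_posdef_ge0 // andbT; apply: contra_neq.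
rewrite frob_mull_qform => /eqP; rewrite psumr_eq0 => [|j _]; last exact: qform_ge0.
move=> /allP q0; apply/matrixP => i j.
have /eqP := q0 j (mem_index_enum j).
have [/colP/(_ i)|/Sgt0 qj_gt0 qj0] := eqVneq (col j Y) 0; first by rewrite !mxE.
by rewrite qj0 ltxx in qj_gt0.
Qed.

Section PatternSpace.
Context {R : realType} {Nf Nc : nat} (N : {set 'I_Nf * 'I_Nc}).
Implicit Types (U V W Z : 'M[R]_(Nf, Nc)).

Lemma restrict_pattern Z : pattern_space N (restrict N Z).
Proof. by move=> i j /negPf; rewrite mxE => ->. Qed.

Lemma restrict_id W : pattern_space N W -> restrict N W = W.
Proof.
by move=> HW; apply/matrixP => i j; rewrite mxE; case: ifPn => // /HW ->.
Qed.

Lemma restrict_linear : linear (@restrict R Nf Nc N).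
Proof.
move=> a U V; apply/matrixP => i j; rewrite !mxE.
by case: ifP => // _; rewrite mulr0 addr0.
Qed.

(** The entries that [restrict] erases are paired with zeros of [W]. Hence restricted operators can
    be studied through the unrestricted ones. *)
Lemma frob_restrict Z W : pattern_space N W -> frob (restrict N Z) W = frob Z W.
Proof.
move=> HW; apply: eq_bigr => i _; apply: eq_bigr => j _; rewrite mxE.
by case: ifPn => // /HW ->; rewrite !mulr0.
Qed.

Lemma pattern_linear a U V :
  pattern_space N U -> pattern_space N V -> pattern_space N (a *: U + V).
Proof. by move=> HU HV i j ij; rewrite !mxE HU // HV // mulr0 addr0. Qed.

Lemma pattern_sub U V :
  pattern_space N U -> pattern_space N V -> pattern_space N (U - V).
Proof. by move=> HU HV; rewrite addrC -scaleN1r; apply: pattern_linear. Qed.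

Context (T : 'M[R]_(Nf, Nc) -> 'M[R]_(Nf, Nc)) (b : 'M[R]_(Nf, Nc)).
Hypotheses (T_sa : selfadjoint_on (pattern_space N) T)
           (T_pos : posdef_on (pattern_space N) T).

Lemma selfadjoint_onB U V : pattern_space N U -> pattern_space N V ->
  T (U - V) = T U - T V.
Proof.
case: T_sa => _ linT _ HU HV.
by rewrite addrC -scaleN1r linT // scaleN1r addrC.
Qed.

Lemma posdef_on_inj U V : pattern_space N U -> pattern_space N V ->
  T U = T V -> U = V.
Proof.
move=> HU HV TUV; apply/eqP; rewrite -subr_eq0; apply/negPn/negP.
move=> /(T_pos _ (pattern_sub _ _ HU HV)).
by rewrite selfadjoint_onB // TUV subrr frob0l ltxx.
Qed.

(* T is extended by the identity on the orthogonal complement of the pattern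
   space, which yields an injective endomorphism of the whole matrix space. *)
Lemma posdef_on_surj : pattern_space N b ->
  exists2 W, pattern_space N W & T W = b.
Proof.
case: T_sa => T_stable linT _ Hb; pose r := @restrict R Nf Nc N.
pose f Z := T (r Z) + (Z - r Z).
have f_lin : linear f.
  move=> a U V; rewrite /f /r restrict_linear linT; [|exact: restrict_pattern..].
  by rewrite !scalerDr scalerN opprD (addrACA (a *: U)) (addrACA (a *: T _)).
pose g : {linear _ -> _} := HB.pack f (GRing.isLinear.Build R _ _ _ f f_lin).
have rH Z : pattern_space N (r Z) by exact: restrict_pattern.
(* The projection [r] annihilates the complement part [Z - r Z] and fixes [T (r Z)], which lies in
   the pattern space. *)
have rf Z : r (f Z) = T (r Z).
  have rD U V : r (U + V) = r U + r V.
    by rewrite -[U]scale1r /r restrict_linear !scale1r.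
  have rN U : r (- U) = - r U.
    by apply/matrixP => i j; rewrite !mxE; case: ifP => // _; rewrite oppr0.
  rewrite /f !rD rN {1 4}/r !restrict_id ?subrr ?addr0 //.
  exact: T_stable.
(* Projecting [f U = f V] gives [r U = r V] by injectivity of [T]; what remains of the equation is
   then [U = V]. *)
have f_inj : lker (linfun g) == 0%VS.
  apply/lker0P => U V; rewrite !lfunE /= => fUV.
  have rUV : r U = r V by apply: posdef_on_inj => //; rewrite -!rf fUV.
  by move: fUV; rewrite /f rUV => /addrI/addIr.
(* An injective endomorphism in finite dimension is invertible. If [f Z = b], then
   [T (r Z) = r (f Z) = r b = b]. *)
exists (r ((linfun g)^-1%VF b)) => //; rewrite -rf.
have := lker0_lfunVK f_inj b; rewrite lfunE /= => ->.
exact: restrict_id.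
Qed.

Context (F : 'M[R]_(Nf, Nc) -> R).
Hypothesis F_quad : forall W, pattern_space N W ->
  F W = 2^-1 * frob (T W) W - frob W b.

(** Self-adjointness makes the two cross terms equal, and [T W = b] cancels them against the linear
    term. *)
Lemma quadratic_complete_square W V :
  pattern_space N W -> pattern_space N V -> T W = b ->
  F V = F W + 2^-1 * frob (T (V - W)) (V - W).
Proof.
move=> HW HV TW; case: T_sa => _ _ saT.
rewrite !F_quad // selfadjoint_onB // !(frobDl, frobDr, frobNl, frobNr).
rewrite (saT V W) // TW (frobC b W) (frobC b V).
by field.
Qed.

(** The excess of [F V] over [F W] is half the energy of [V - W]: its sign gives minimality, its
    definiteness uniqueness. *)
Lemma quadratic_unique_minimizer W : pattern_space N W -> T W = b ->
  unique (minimizer_on (pattern_space N) F) W.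
Proof.
move=> HW TW; split.
  split=> // V HV; rewrite (quadratic_complete_square W V) // lerDl.
  have [->|VW] := eqVneq (V - W) 0; first by rewrite frobC frob0l mulr0.
  by rewrite mulr_ge0 ?invr_ge0 // ltW // T_pos //; apply: pattern_sub.
move=> V [HV /(_ W HW)]; rewrite (quadratic_complete_square W V) // gerDl.
move=> sq_le0; apply/eqP; rewrite eq_sym -subr_eq0; apply/negPn/negP.
move=> /(T_pos _ (pattern_sub _ _ HV HW)).
by rewrite -(pmulr_rgt0 _ (_ : 0 < 2^-1 :> R)) ?invr_gt0 // ltNge sq_le0.
Qed.

End PatternSpace.

Section RestrictedOperator.
Context {R : realType} {Nf Nc nB : nat} {tau c2 : R}.
Context {A X : 'M[R]_(Nf + Nc)} {B : 'M[R]_(Nf + Nc, nB)}.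
Context (N : {set 'I_Nf * 'I_Nc}).

Lemma Lop_linear : linear (Lop tau c2 A X B).
Proof.
move=> a U V; rewrite /Lop !mulmxDr !mulmxDl -!(scalemxAr, scalemxAl).
by rewrite !scalerDr !scalerA !(mulrC a) addrACA.
Qed.

(** Moving [Bc^T] to the other argument exhibits the second term as the form of [Xff] at [U *m Bc]
    and [V *m Bc], so symmetry and positivity can be read off. *)
Lemma frob_Lop U V : frob (Lop tau c2 A X B U) V =
  tau * frob (ulsubmx A *m U) V
  + c2 * (1 - tau) * frob (ulsubmx X *m (U *m dsubmx B)) (V *m dsubmx B).
Proof.
by rewrite frobDl !frobZl (frob_mulr _ _^T) trmxK -!mulmxA.
Qed.

Lemma Ffun_quadratic W : pattern_space N W -> Ffun tau c2 A X B W =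
  2^-1 * frob (Lhat tau c2 A X B N W) W - frob W (Bhat tau c2 A X B N).
Proof.
move=> HW; rewrite frob_restrict // (frobC W) frob_restrict // /Ffun (frobC W).
by rewrite /Brhs /Lop !frobDl !frobZl; field.
Qed.

Lemma Lhat_selfadjoint : (ulsubmx A)^T = ulsubmx A -> (ulsubmx X)^T = ulsubmx X ->
  selfadjoint_on (pattern_space N) (Lhat tau c2 A X B N).
Proof.
move=> symA symX; split=> [U _|a U V _ _|U V HU HV].
- exact: restrict_pattern.
- by rewrite /Lhat Lop_linear restrict_linear.
rewrite frob_restrict // [RHS]frobC frob_restrict // !frob_Lop.
by rewrite frob_mull_sym // (frob_mull_sym _ (U *m _)).
Qed.

Lemma Lhat_posdef : sym_posdef (ulsubmx A) -> sym_posdef (ulsubmx X) ->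
  0 < c2 -> 0 <= tau < 1 ->
  (tau = 0 -> pattern_rows_independent N (dsubmx B)) ->
  posdef_on (pattern_space N) (Lhat tau c2 A X B N).
Proof.
move=> posA posX c2_gt0 /andP[tau_ge0 tau_lt1] indep U HU U0.
rewrite frob_restrict // frob_Lop.
have c_gt0 : 0 < c2 * (1 - tau) by rewrite mulr_gt0 // subr_gt0.
have [tau0|tau_neq0] := eqVneq tau 0; last first.
  apply: ltr_wpDr; first by rewrite mulr_ge0 ?(ltW c_gt0) ?frob_posdef_ge0.
  by rewrite mulr_gt0 ?frob_posdef_gt0 // lt_def tau_neq0.
(* Only the coefficient of the [Aff] term is replaced by 0; [1 - tau] stays intact so that [c_gt0]
   still applies. *)
rewrite [Z in Z * frob (ulsubmx A *m _) _]tau0 mul0r add0r.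
rewrite mulr_gt0 // frob_posdef_gt0 //; apply: contra_neq U0 => UB0.
(* Row [i] of [U] is supported on row [i] of the pattern and annihilated by [Bc], so independence
   makes it zero. *)
apply/row_matrixP => i; rewrite row0; apply: (indep tau0 i).
  by move=> j /HU; rewrite mxE.
by rewrite -row_mul UB0 row0.
Qed.

End RestrictedOperator.

Theorem mainTheorem1 (R : realType) (Nf Nc nB : nat)
    (A M X : 'M[R]_(Nf + Nc)) (B : 'M[R]_(Nf + Nc, nB))
    (c1 c2 tau : R) (N : {set 'I_Nf * 'I_Nc})
    (hA : sym_posdef A)
    (hM : relaxation_operator A M)
    (hX : spectrally_equivalent c1 c2 X (symmetrized_relaxation A M))
    (hAff : sym_posdef (ulsubmx A))
    (hXff : sym_posdef (ulsubmx X))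
    (hB : orthonormal_cols A B)
    (htau : 0 <= tau < 1)
    (htau0 : tau = 0 -> pattern_rows_independent N (dsubmx B)) :
  [/\ forall W, pattern_space N W ->
        Ffun tau c2 A X B W
        = 2^-1 * frob (Lhat tau c2 A X B N W) W - frob W (Bhat tau c2 A X B N),
      selfadjoint_on (pattern_space N) (Lhat tau c2 A X B N),
      posdef_on (pattern_space N) (Lhat tau c2 A X B N) &
      exists W : 'M[R]_(Nf, Nc),
        unique (minimizer_on (pattern_space N) (Ffun tau c2 A X B)) W
        /\ unique (fun V => pattern_space N V
                            /\ Lhat tau c2 A X B N V = Bhat tau c2 A X B N) W].
Proof.
have [c1_gt0 c12 _] := hX.
have quad := Ffun_quadratic (tau := tau) (c2 := c2) (A := A) (X := X) (B := B) N.
have sa := Lhat_selfadjoint (tau := tau) (c2 := c2) (B := B) N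
  (proj1 hAff) (proj1 hXff).
(* Positivity of [c2] comes from the spectral equivalence constants, [0 < c1 <= c2]. *)
have pos := Lhat_posdef N hAff hXff (lt_le_trans c1_gt0 c12) htau htau0.
have [W HW LW] := posdef_on_surj N _ _ sa pos
  (restrict_pattern N (Brhs tau c2 A X B)).
split=> //; exists W; split; first exact: (quadratic_unique_minimizer N _ _ sa pos _ quad).
split=> // V [HV LV]; apply: (posdef_on_inj N _ sa pos) => //.
by rewrite LV.
Qed.
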